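(* Fix $d,k\in\mathbb{N}_+$ and $\epsilon>0$. Let $A$ be the set of finite $(\epsilon,k)$-hyper-finite graphs with all vertex degrees at most $d$, and let $B$ be the set of finite graphs with all vertex degrees at most $d$ that are not $\bigl(4\epsilon\log(4d/\epsilon),k\bigr)$-hyper-finite. Then there is some $R=R(d,k,\epsilon)\in\mathbb{N}_+$ such that $\rho_R(A,B)>0$.
   Context: A graph $G=(V,E)$ is $(\delta,k)$-hyper-finite if one can remove at most $\delta|V|$ edges from $G$ and obtain a graph all of whose connected components have at most $k$ vertices. A rooted graph is a pair $(G,v)$ with $v\in V(G)$; an isomorphism of rooted graphs is a graph isomorphism preserving the root. For $v\in V(G)$, $B_G(v,r)$ is the subgraph of $G$ induced on the vertices at distance at most $r$ from $v$. For a rooted graph $H$ and finite graph $G$, $\mu^G_r(H)$ is the fraction of vertices $v\in V(G)$ such that $(B_G(v,r),v)$ is isomorphic to $H$. Define $\rho_r(G,G')=\sum_H|\mu^G_r(H)-\mu^{G'}_r(H)|$ over all isomorphism types $H$ of rooted graphs, and $\rho_r(A,B)=\inf\{\rho_r(G,G'):G\in A,G'\in B\}$. Here $\log$ denotes the natural logarithm.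
   Formalization: The claim fails for large ε (d=k=1, ε=4: a single edge is in both A and B), so it is assumed that if ε ≥ d/2 then d/2 ≤ 4ε log(4d/ε); this excludes only ε above about 3.87d, including, for k ≥ 2, some ε near 4d where B is empty and the claim holds vacuously. *)

(* Defs.v *)
From HB Require Import structures.
From mathcomp Require Import all_boot all_order all_algebra.
From mathcomp Require Import generic_quotient.
From mathcomp Require Import all_classical all_reals all_analysis.

Set Implicit Arguments.
Unset Strict Implicit.
Unset Printing Implicit Defensive.

Import Order.TTheory GRing.Theory Num.Theory.
Local Open Scope ring_scope.

Record sgraph := SGraph {
  vertex :> finType;
  adj : rel vertex;
  adj_sym : symmetric adj;
  adj_irrefl : irreflexive adj }.

Section GraphOfEdges.
Variables (T : finType) (E : {set {set T}}).

(* Members of E that are not pairs of distinct vertices are ignored. *)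
Definition pair_adj : rel T := fun x y => (x != y) && ([set x; y] \in E).

Lemma pair_adj_sym : symmetric pair_adj.
Proof. by move=> x y; rewrite /pair_adj eq_sym finset.setUC. Qed.

Lemma pair_adj_irrefl : irreflexive pair_adj.
Proof. by move=> x; rewrite /pair_adj eqxx. Qed.

Definition graph_of_edges : sgraph := SGraph pair_adj_sym pair_adj_irrefl.

End GraphOfEdges.

Definition edges (G : sgraph) : {set {set G}} :=
  [set e | [exists x, exists y, adj x y && (e == [set x; y])]].

Definition component (G : sgraph) (x : G) : {set G} :=
  [set y | connect (@adj G) x y].

Definition max_degree_le (d : nat) (G : sgraph) : Prop :=
  forall x : G, (#|[set y | adj x y]| <= d)%N.

Definition hyperfinite (R : realType) (delta : R) (k : nat) (G : sgraph) :
    Prop :=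
  exists F : {set {set G}},
    [/\ F \subset edges G,
        #|F|%:R <= delta * #|G|%:R &
        forall x : graph_of_edges (edges G :\: F), (#|component x| <= k)%N].

Record rooted_graph := RootedGraph {
  rooted_base :> sgraph;
  basepoint : rooted_base }.

Definition rooted_iso (H K : rooted_graph) : Prop :=
  exists f : H -> K,
    [/\ bijective f,
        forall x y, adj (f x) (f y) = adj x y &
        f (basepoint H) = basepoint K].

Definition dist_le (G : sgraph) (r : nat) (x y : G) : bool :=
  [exists n : 'I_r.+1, exists p : n.-tuple G,
     path (@adj G) x p && (last x p == y)].

Section Induced.
Variables (G : sgraph) (S : {set G}).

Definition induced_adj : rel {x : G | x \in S} :=
  fun x y => adj (val x) (val y).

Lemma induced_adj_sym : symmetric induced_adj.
Proof. by move=> x y; exact: adj_sym. Qed.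

Lemma induced_adj_irrefl : irreflexive induced_adj.
Proof. by move=> x; exact: adj_irrefl. Qed.

Definition induced_subgraph : sgraph := SGraph induced_adj_sym induced_adj_irrefl.

End Induced.

Definition ball_set (G : sgraph) (v : G) (r : nat) : {set G} :=
  [set u | dist_le r v u].

Lemma ball_root_subproof (G : sgraph) (v : G) (r : nat) : v \in ball_set v r.
Proof.
rewrite inE; apply/existsP; exists ord0; apply/existsP; exists [tuple].
by rewrite /= eqxx.
Qed.

Definition rooted_ball (G : sgraph) (v : G) (r : nat) : rooted_graph :=
  @RootedGraph (induced_subgraph (ball_set v r)) (exist _ v (ball_root_subproof v r)).

(* For the graph with no vertices this is 0, as 0 / 0 = 0. *)
Definition mu (R : realType) (r : nat) (G : sgraph) (H : rooted_graph) : R :=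
  #|[set v : G | `[< rooted_iso (rooted_ball v r) H >]]|%:R / #|G|%:R.

(* Rooted graphs on an initial segment of nat: a small type containing a copy
   of every finite rooted graph.  Its quotient by isomorphism is the type of
   isomorphism types of finite rooted graphs (infinite ones have mu = 0). *)
Definition rcode : choiceType := {n : nat & ({set {set 'I_n}} * 'I_n)%type}.

Definition rooted_graph_of_code (c : rcode) : rooted_graph :=
  @RootedGraph (graph_of_edges (tagged c).1) (tagged c).2.

Definition rcode_iso : rel rcode :=
  fun c c' =>
    `[< rooted_iso (rooted_graph_of_code c) (rooted_graph_of_code c') >].

Lemma rooted_iso_refl (H : rooted_graph) : rooted_iso H H.
Proof. by exists id; split=> //; exists id. Qed.

Lemma rooted_iso_sym (H K : rooted_graph) : rooted_iso H K -> rooted_iso K H.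
Proof.
move=> [f [[g fK gK] fadj froot]]; exists g; split.
- by exists f.
- by move=> x y; rewrite -fadj !gK.
- by rewrite -froot fK.
Qed.

Lemma rooted_iso_trans (H K L : rooted_graph) :
  rooted_iso H K -> rooted_iso K L -> rooted_iso H L.
Proof.
move=> [f [bf fadj froot]] [g [bg gadj groot]]; exists (g \o f); split.
- exact: bij_comp.
- by move=> x y; rewrite /= gadj fadj.
- by rewrite /= froot groot.
Qed.

Lemma rcode_iso_refl : reflexive rcode_iso.
Proof. by move=> c; apply/asboolP/rooted_iso_refl. Qed.

Lemma rcode_iso_sym : symmetric rcode_iso.
Proof. by move=> c c'; apply/asboolP/asboolP => /rooted_iso_sym. Qed.

Lemma rcode_iso_trans : transitive rcode_iso.
Proof.
move=> c c' c'' /asboolP h /asboolP h'; apply/asboolP.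
exact: rooted_iso_trans h h'.
Qed.

Canonical rcode_iso_equiv :=
  EquivRel rcode_iso rcode_iso_refl rcode_iso_sym rcode_iso_trans.

Definition rooted_graph_type : choiceType := {eq_quot rcode_iso}%qT.

Definition rooted_graph_of_type (H : rooted_graph_type) : rooted_graph :=
  rooted_graph_of_code (repr H).

Definition rho (R : realType) (r : nat) (G G' : sgraph) : \bar R :=
  (\esum_(H in [set: rooted_graph_type])
     (`| mu R r G (rooted_graph_of_type H)
         - mu R r G' (rooted_graph_of_type H) |%R)%:E)%E.

(* A class of graphs is a predicate, [sgraph] being too large for [set sgraph].
   The infimum over an empty family is +oo. *)
Definition rho_inf (R : realType) (r : nat) (A B : sgraph -> Prop) : \bar R :=
  ereal_inf [set x : \bar R |
    exists G G', [/\ A G, B G' & x = rho R r G G']].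

(* Main.v *)
Require Import Defs.
From mathcomp Require Import all_boot all_order all_algebra.
From mathcomp Require Import generic_quotient.
From mathcomp Require Import all_classical all_reals all_analysis.
From mathcomp Require Import zify ring lra.
Set Implicit Arguments.
Unset Strict Implicit.
Unset Printing Implicit Defensive.
Import Order.TTheory GRing.Theory Num.Theory.
Local Open Scope ring_scope.

(* Assign a weight x K >= 0 to every set K of at most k vertices that are
   pairwise at distance at most k, at cost (number of edges leaving K) * x K,
   plus d times the amount by which each vertex fails to be covered with total
   weight 1.  If G is (eps, k)-hyper-finite, the indicator of its components
   costs at most 2 eps |G|.  Projected subgradient descent then reaches cost
   3 eps |G| in a number T of steps depending only on d, k and eps, and each
   step is local: the cost incurred at a vertex after t steps is a bounded
   function of the ball of radius (t + 2) k + 1 around it.  Hence if the ball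
   statistics of G and G' are close, the descent on G' reaches cost at most
   4 eps |G'| as well.  Greedy set cover rounds such a fractional cover to a
   set of edges cutting G' into pieces of size at most k, losing a factor
   logarithmic in d / eps. *)

(** * Balls in the graph metric *)

Lemma dist_leP (G : sgraph) (r : nat) (x y : G) :
  reflect (exists p, [/\ (size p <= r)%N, path (@adj G) x p & last x p = y])
          (dist_le r x y).
Proof.
apply: (iffP existsP) => [[n /existsP[p /andP[hp /eqP hl]]]|[p [hs hp hl]]].
  by exists p; rewrite size_tuple -ltnS ltn_ord.
have hs' : (size p < r.+1)%N by [].
by exists (Ordinal hs'); apply/existsP; exists (in_tuple p); rewrite /= hp hl eqxx.
Qed.

Lemma ball_setP (G : sgraph) (r : nat) (x y : G) :
  reflect (exists p, [/\ (size p <= r)%N, path (@adj G) x p & last x p = y])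
          (y \in ball_set x r).
Proof. by rewrite inE; exact: dist_leP. Qed.

Lemma ball_set_trans (G : sgraph) (a b : nat) (x y z : G) :
  y \in ball_set x a -> z \in ball_set y b -> z \in ball_set x (a + b).
Proof.
move=> /ball_setP[p [sp hp <-]] /ball_setP[q [sq hq <-]].
by apply/ball_setP; exists (p ++ q); rewrite size_cat leq_add // cat_path hp hq last_cat.
Qed.

Lemma ball_set_mono (G : sgraph) (a b : nat) (x : G) :
  (a <= b)%N -> ball_set x a \subset ball_set x b.
Proof.
move=> ab; apply/fintype.subsetP => y /ball_setP[p [sp hp hl]].
by apply/ball_setP; exists p; split=> //; exact: leq_trans ab.
Qed.

Lemma ball_set_adj (G : sgraph) (x y : G) : adj x y -> y \in ball_set x 1.
Proof. by move=> xy; apply/ball_setP; exists [:: y]; rewrite /= xy. Qed.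

Lemma ball_set0 (G : sgraph) (x : G) : ball_set x 0 = [set x].
Proof.
apply/setP => y; rewrite finset.in_set1; apply/ball_setP/eqP => [[p []]|->].
  by rewrite leqn0 size_eq0 => /eqP-> _ <-.
by exists [::].
Qed.

Lemma ball_setS (G : sgraph) (x y : G) (r : nat) :
  y \in ball_set x r.+1 ->
  y \in ball_set x r \/ exists2 z, z \in ball_set x r & adj z y.
Proof.
move=> /ball_setP[p]; elim/last_ind: p => [|p z _] [sp hp hl].
  by left; rewrite -hl; exact: ball_root_subproof.
right; move: sp hp hl; rewrite size_rcons rcons_path last_rcons ltnS.
move=> sp /andP[hp az] <-; exists (last x p) => //.
by apply/ball_setP; exists p.
Qed.

(** Enlarging the radius by one replaces each vertex by itself and at most [d] neighbours. *)
Lemma card_ball_set (d : nat) (G : sgraph) (x : G) (r : nat) :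
  max_degree_le d G -> (#|ball_set x r| <= d.+1 ^ r)%N.
Proof.
move=> dG; elim: r => [|r IH]; first by rewrite ball_set0 cards1.
have sub : ball_set x r.+1 \subset
    \bigcup_(z in ball_set x r) (z |: [set y | adj z y]).
  apply/fintype.subsetP => y /ball_setS[yr|[z zr zy]].
    by apply/bigcupP; exists y => //; rewrite !inE eqxx.
  by apply/bigcupP; exists z => //; rewrite !inE zy orbT.
apply: leq_trans (subset_leq_card sub) _.
apply: (@leq_trans (\sum_(z in ball_set x r) d.+1)).
  apply: (@leq_trans (\sum_(z in ball_set x r) #|z |: [set y | adj z y]|)).
    elim/big_rec2: _ => [|z m A _ hA]; first by rewrite finset.cards0.
    by apply: leq_trans (leq_card_setU _ _).1 _; rewrite leq_add2l.
  apply: leq_sum => z _; apply: leq_trans (leq_card_setU _ _).1 _.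
  by rewrite cards1 add1n ltnS; exact: dG.
by rewrite sum_nat_const expnS mulnC leq_mul2l IH orbT.
Qed.

(** * Edge boundaries, and components after deleting edges *)

Definition boundary_size (G : sgraph) (K : {set G}) : nat :=
  (\sum_(u in K) #|[set w | adj u w & w \notin K]|)%N.

Lemma boundary_size_le (d : nat) (G : sgraph) (K : {set G}) :
  max_degree_le d G -> (boundary_size K <= d * #|K|)%N.
Proof.
move=> dG; rewrite mulnC -sum_nat_const; apply: leq_sum => u _.
apply: leq_trans (dG u); apply: subset_leq_card.
by apply/fintype.subsetP => w; rewrite !inE => /andP[].
Qed.

Lemma edgesP (G : sgraph) (e : {set G}) :
  reflect (exists x y, adj x y /\ e = [set x; y]) (e \in edges G).
Proof.
rewrite inE; apply: (iffP existsP) => [[x /existsP[y /andP[xy /eqP->]]]|].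
  by exists x, y.
by move=> [x [y [xy ->]]]; exists x; apply/existsP; exists y; rewrite xy eqxx.
Qed.

Lemma set2_inj (T : finType) (x y u w : T) :
  [set x; y] = [set u; w] -> (x = u /\ y = w) \/ (x = w /\ y = u).
Proof.
move=> E; have := set21 x y; have := set22 x y; have := set21 u w.
have := set22 u w; rewrite -{1 2}E {3 4}E !inE.
by do 4![case/orP => /eqP ?]; subst; auto.
Qed.

Lemma mem_edges2 (G : sgraph) (x y : G) : ([set x; y] \in edges G) = adj x y.
Proof.
apply/edgesP/idP => [[u [w [uw /set2_inj[[-> ->]|[-> ->]]]]]|xy] //.
  by rewrite adj_sym.
by exists x, y.
Qed.

(** Boundaries are counted as ordered pairs and deletions as unordered ones. Each edge has two
    orientations, distinct because there are no loops. *)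
Lemma card_directed_edges (G : sgraph) (F : {set {set G}}) :
  F \subset edges G -> #|[set p : G * G | [set p.1; p.2] \in F]| = (#|F| * 2)%N.
Proof.
move=> FE; rewrite -sum1_card.
rewrite (partition_big (fun p : G * G => [set p.1; p.2]) (mem F)) /=; last first.
  by move=> p; rewrite inE.
rewrite -sum_nat_const; apply: eq_bigr => e eF.
have /edgesP[x [y [xy ee]]] := fintype.subsetP FE _ eF.
have nxy : (x, y) != (y, x) :> G * G.
  by apply: contraTneq xy => -[-> _]; rewrite adj_irrefl.
rewrite sum1dep_card (_ : [set _ | _] = [set (x, y); (y, x)]) ?cards2 ?nxy //.
apply/setP => -[u w]; rewrite !inE /= ee; apply/andP/orP.
  by move=> [_ /eqP/set2_inj[[-> ->]|[-> ->]]]; [left|right].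
by move=> [/eqP[-> ->]|/eqP[-> ->]]; rewrite ?(finset.setUC [set y]) -ee eF.
Qed.

Lemma adj_del (G : sgraph) (F : {set {set G}}) (x y : G) :
  pair_adj (edges G :\: F) x y = adj x y && ([set x; y] \notin F).
Proof.
rewrite /pair_adj finset.in_setD mem_edges2 [_ && adj _ _]andbC.
by case: eqVneq => // ->; rewrite adj_irrefl.
Qed.

Lemma edges_boundary_bound (G : sgraph) (K : {set G}) :
  exists F : {set {set G}}, [/\ F \subset edges G, (#|F| <= boundary_size K)%N &
   forall u w, adj u w -> u \in K -> w \notin K -> [set u; w] \in F].
Proof.
pose P := [set p : G * G | [&& p.1 \in K, p.2 \notin K & adj p.1 p.2]].
exists [set [set p.1; p.2] | p in P]; split.
- apply/fintype.subsetP => e /imsetP[p]; rewrite inE => /and3P[_ _ h] ->.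
  by rewrite mem_edges2.
- apply: leq_trans (leq_imset_card _ _) _.
  rewrite -sum1_card (partition_big (fun p : G * G => p.1) (mem K)) /=; last first.
    by move=> p; rewrite inE => /andP[].
  apply: leq_sum => u uK; rewrite sum1dep_card.
  rewrite -(card_imset [set w | adj u w & w \notin K] (f := pair u)); last by move=> ? ? [].
  apply: subset_leq_card; apply/fintype.subsetP => -[a b]; rewrite !inE /= => /andP[/and3P[aK bK ab] /eqP ea].
  by apply/imsetP; exists b; rewrite ?inE -?ea ?ab.
- by move=> u w uw uK wK; apply/imsetP; exists (u, w); rewrite // inE /= uK wK uw.
Qed.

Lemma component_del_mono (G : sgraph) (E1 E2 : {set {set G}}) (x : G) :
  E1 \subset E2 ->
  (#|@component (graph_of_edges (edges G :\: E2)) x|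
   <= #|@component (graph_of_edges (edges G :\: E1)) x|)%N.
Proof.
move=> sub; apply: subset_leq_card; apply/fintype.subsetP => y; rewrite !inE.
apply: connect_sub => u w; rewrite /= adj_del => /andP[uw nF].
apply: connect1; rewrite /= adj_del uw /=.
by apply: contraNN nF; exact: fintype.subsetP.
Qed.

(** A path from [x] would have to leave [K] for the first time through a deleted edge. *)
Lemma component_del_boundary (G : sgraph) (F : {set {set G}}) (K : {set G}) (x : G) :
  (forall u w, adj u w -> u \in K -> w \notin K -> [set u; w] \in F) ->
  x \in K -> @component (graph_of_edges (edges G :\: F)) x \subset K.
Proof.
move=> hF xK; apply/fintype.subsetP => y; rewrite inE => /connectP[p hp ->].
elim: p x xK hp => //= w p IH x xK; rewrite adj_del.
move=> /andP[/andP[xw nF]]; apply: IH.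
by apply: contraNT nF; exact: hF.
Qed.

(** * Greedy rounding of a fractional cover *)

Section Rounding.
Variable R : realType.

(* Bounds the number of edges the greedy algorithm removes while [u] vertices
   remain uncovered, [C] being the cost of the fractional cover; below
   [u = C / d] it is cheaper to isolate the remaining vertices. *)
Definition greedy_cost (C d u : R) : R :=
  if u * d <= C then d * u else C * (1 + ln (u * d / C)).

(** The inequality ln (1 + y) <= y at y = 1/x - 1. *)
Lemma ln_ge1BV (x : R) : 0 < x -> 1 - x^-1 <= ln x.
Proof.
move=> x0; have := @le_ln1Dx R (x^-1 - 1); rewrite ltrBrDr addNr invr_gt0 x0 => /(_ isT).
by rewrite addrC subrK lnV ?posrE //; lra.
Qed.

(* [greedy_cost C d] is concave with derivative [min d (C / u)]. *)
Lemma greedy_cost_step (C d u m : R) : 0 < C -> 0 < d -> 0 <= m -> m <= u -> C < u * d ->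
  C * m / u + greedy_cost C d (u - m) <= greedy_cost C d u.
Proof.
move=> C0 d0 m0 mu Cud; have u0 : 0 < u by rewrite -(pmulr_lgt0 _ d0); lra.
rewrite /greedy_cost [u * d <= C]leNgt Cud /=.
case: ifP => h.
  (* Here [u - m] is in the linear range. The lower bound on ln (u d / C) reduces the claim to (C -
     (u - m) d) (u d - C) >= 0. *)
  have := ln_ge1BV (x := u * d / C).
  have -> : (u * d / C)^-1 = C / (u * d) by rewrite invfM invrK mulrC.
  move=> /(_ (divr_gt0 (lt_trans C0 Cud) C0)) hl.
  apply: le_trans (_ : C * (2 - C / (u * d)) <= _); last by rewrite ler_pM2l //; lra.
  rewrite -subr_ge0.
  have -> : C * (2 - C / (u * d)) - (C * m / u + d * (u - m)) =
    (C - (u - m) * d) * (u * d - C) / (u * d).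
    by field; rewrite !gt_eqF.
  by rewrite divr_ge0 // ?mulr_ge0 //; lra.
have um : 0 < u - m.
  by rewrite -(pmulr_lgt0 _ d0); move/negbT: h; rewrite -ltNge; lra.
(* Both arguments are in the logarithmic range, so the claim becomes m / u <= ln (u / (u - m)). *)
have := ln_ge1BV (x := u / (u - m)) (divr_gt0 u0 um); rewrite invf_div => hl.
have -> : ln (u * d / C) = ln (u / (u - m)) + ln ((u - m) * d / C).
  rewrite -lnM ?posrE ?divr_gt0 ?mulr_gt0 //; congr (ln _).
  by field; rewrite !gt_eqF.
rewrite -subr_ge0.
set A := ln (u / _) in hl *; set B := ln _.
have -> : C * (1 + (A + B)) - (C * m / u + C * (1 + B)) = C * (A - m / u) by field; rewrite gt_eqF.
apply: mulr_ge0; first exact: ltW.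
have <- : 1 - (u - m) / u = m / u; last by rewrite subr_ge0.
by field; rewrite gt_eqF.
Qed.

(** Induction on the set [U] of vertices still to be covered. While [U] is large, some [K] of
    positive weight has boundary at most C / |U| per vertex of [U] that it covers. Its boundary is
    deleted and [U :\: K] remains, with the same [x] and [C]. *)
Lemma greedy_partition (G : sgraph) (d k : nat) (x : {set G} -> R) (C : R) (U : {set G}) :
    (0 < d)%N -> (0 < k)%N -> max_degree_le d G -> 0 < C ->
    (forall K, 0 <= x K) -> (forall K, x K != 0 -> (#|K| <= k)%N) ->
    (forall v, 1 <= \sum_(K : {set G} | v \in K) x K) ->
    \sum_K x K * (boundary_size K)%:R <= C ->
  exists F : {set {set G}}, [/\ F \subset edges G,
    #|F|%:R <= greedy_cost C d%:R #|U|%:R &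
    forall v, v \in U -> (#|@component (graph_of_edges (edges G :\: F)) v| <= k)%N].
Proof.
move=> d0 k0 dG C0 x0 xk xcov xC.
have d0' : 0 < d%:R :> R by rewrite ltr0n.
have [n] := ubnP #|U|; elim: n U => // n IH U; rewrite ltnS => Un.
have [small|big] := leP (#|U|%:R * d%:R) C.
  (* Few vertices remain: all edges at [U] are deleted, which isolates each of them. *)
  pose F := \bigcup_(u in U) [set [set u; w] | w in [set w | adj u w]].
  exists F; split.
  - apply/bigcupsP => u _; apply/fintype.subsetP => e /imsetP[w]; rewrite inE => uw ->.
    by rewrite mem_edges2.
  - rewrite /greedy_cost small -natrM ler_nat mulnC -sum_nat_const.
    apply: (@leq_trans (\sum_(u in U) #|[set [set u; w] | w in [set w | adj u w]]|)).
      rewrite /F; elim/big_rec2: _ => [|z m A _ hA]; first by rewrite finset.cards0.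
      by apply: leq_trans (leq_card_setU _ _).1 _; rewrite leq_add2l.
    by apply: leq_sum => u _; apply: leq_trans (leq_imset_card _ _) _; exact: dG.
  - move=> v vU; apply: leq_trans k0; rewrite -(cards1 v); apply: subset_leq_card.
    apply: component_del_boundary; last exact: set11.
    move=> u w uw; rewrite finset.in_set1 => /eqP eu _; apply/bigcupP; exists v => //.
    by apply/imsetP; exists w; rewrite ?inE -eu.
have u0 : 0 < #|U|%:R :> R by rewrite -(pmulr_lgt0 _ d0'); exact: lt_trans big.
have [K xK0 Kc] : exists2 K, (0 < x K * #|K :&: U|%:R) &
    (boundary_size K)%:R <= C * #|K :&: U|%:R / #|U|%:R.
  (* Double counting of the pairs (v, K) with v in [K :&: U], weighted by [x K]. *)
  have covU : #|U|%:R <= \sum_K x K * #|K :&: U|%:R.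
    have -> : \sum_K x K * #|K :&: U|%:R = \sum_(v in U) \sum_(K : {set G} | v \in K) x K.
      rewrite (exchange_big_dep predT) //=; apply: eq_bigr => K _.
      rewrite sumr_const -[RHS]mulr_natr; congr (_ * _%:R); apply: eq_card => v.
      by rewrite inE andbC.
    by rewrite -sumr_const ler_sum.
  (* If every [K] with positive weight meeting [U] were dearer than this average rate, summing
     against [x] would give a total cost above [C]. By [covU] at least one such [K] exists, so the
     inequality is strict. *)
  apply: contrapT => H.
  have H' K : 0 < x K * #|K :&: U|%:R ->
     C * #|K :&: U|%:R / #|U|%:R < (boundary_size K)%:R.
    by move=> h; rewrite ltNge; apply/negP => h'; apply: H; exists K.
  have : \sum_K x K * (C * #|K :&: U|%:R / #|U|%:R) < \sum_K x K * (boundary_size K)%:R.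
    have [K hK] : exists K, 0 < x K * #|K :&: U|%:R.
      apply: contrapT => H2; move: covU; rewrite leNgt => /negP; apply.
      rewrite big1 // => K _; apply/eqP; rewrite eq_le mulr_ge0 // andbT leNgt.
      by apply/negP => h; apply: H2; exists K.
    rewrite (bigD1 K) //= [ltRHS](bigD1 K) //=; apply: ltr_leD.
      rewrite ltr_pM2l ?H' // lt_neqAle x0 andbT eq_sym.
      by apply: contraTneq hK => ->; rewrite mul0r ltxx.
    apply: ler_sum => L _; have [hL|hL] := ltP 0 (x L * #|L :&: U|%:R).
      by rewrite ler_wpM2l // ltW // H'.
    have /eqP e0 : x L * #|L :&: U|%:R == 0 by rewrite eq_le hL mulr_ge0.
    have -> : x L * (C * #|L :&: U|%:R / #|U|%:R) = x L * #|L :&: U|%:R * (C / #|U|%:R) by ring.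
    by rewrite e0 mul0r mulr_ge0.
  apply/negP; rewrite -leNgt (le_trans xC) //.
  have -> : \sum_K x K * (C * #|K :&: U|%:R / #|U|%:R) =
      (\sum_K x K * #|K :&: U|%:R) * (C / #|U|%:R).
    by rewrite mulr_suml; apply: eq_bigr => K _; ring.
  by rewrite mulrA ler_pdivlMr // mulrC ler_pM2r.
have xK : (#|K| <= k)%N.
  by apply: xk; apply: contraTneq xK0 => ->; rewrite mul0r ltxx.
have KU : (0 < #|K :&: U|)%N.
  by rewrite lt0n; apply: contraTneq xK0 => ->; rewrite mulr0 ltxx.
have cU : #|U :\: K|%:R = #|U|%:R - #|K :&: U|%:R :> R.
  by rewrite -(cardsID K U) natrD finset.setIC addrAC subrr add0r.
have [F1 [F1E F1c F1k]] : exists F : {set {set G}}, [/\ F \subset edges G,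
    #|F|%:R <= greedy_cost C d%:R #|U :\: K|%:R &
    forall v, v \in U :\: K -> (#|@component (graph_of_edges (edges G :\: F)) v| <= k)%N].
  apply: IH; apply: leq_trans Un; rewrite -(cardsID K U) -addn1 addnC leq_add2r.
  by rewrite finset.setIC.
have [F2 [F2E F2c F2k]] := edges_boundary_bound K.
exists (F2 :|: F1); split.
- by rewrite finset.subUset F2E.
- apply: le_trans (_ : (#|F2| + #|F1|)%:R <= _).
    by rewrite ler_nat; exact: (leq_card_setU _ _).1.
  rewrite natrD; apply: le_trans (greedy_cost_step C0 d0' (ler0n _ #|K :&: U|) _ big).
    rewrite -cU lerD //; apply: le_trans Kc; by rewrite ler_nat.
  by rewrite ler_nat subset_leq_card // finset.subsetIr.
- move=> v vU; have [vK|vK] := boolP (v \in K).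
    apply: leq_trans xK; apply: subset_leq_card; apply: component_del_boundary vK.
    by move=> u w uw uK wK; rewrite inE F2k.
  apply: leq_trans (F1k v _); last by rewrite inE vK.
  by apply: component_del_mono; exact: finset.subsetUr.
Qed.
End Rounding.

(** * Projected subgradient descent on weights of clusters *)

Definition kcluster (k : nat) (G : sgraph) (K : {set G}) : bool :=
  (#|K| <= k)%N && [forall u in K, K \subset ball_set u k].

Lemma kcluster_sub (k : nat) (G : sgraph) (K : {set G}) (v : G) :
  kcluster k K -> v \in K -> K \subset ball_set v k.
Proof. by move=> /andP[_ /forall_inP h]; exact: h. Qed.

Section Descent.
Variables (R : realType) (d k : nat) (eta : R).

Section Functionals.
Variables (G : sgraph) (x : {set G} -> R).

Definition coverage (v : G) : R := \sum_(K : {set G} | v \in K) x K.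
Definition deficit (v : G) : R := Num.max 0 (1 - coverage v).
Definition objective : R :=
  \sum_K x K * (boundary_size K)%:R + d%:R * \sum_v deficit v.
(** Partial derivative of [objective] in the coordinate [x K]; at the kink [coverage v = 1] the
    slope 0 is chosen. *)
Definition subgradient (K : {set G}) : R :=
  (boundary_size K)%:R - d%:R * #|[set v in K | coverage v < 1]|%:R.
(* Truncating at 0 projects onto the nonnegative weights. *)
Definition descent_step (K : {set G}) : R :=
  if kcluster k K then Num.max 0 (x K - eta * subgradient K) else 0.

End Functionals.

Definition descent (G : sgraph) (t : nat) : {set G} -> R :=
  iter t (@descent_step G) (fun=> 0).

(** Convexity: the boundary term is linear in the weights, and each deficit is the maximum of two
    affine functions. *)
Lemma subgradientP (G : sgraph) (x y : {set G} -> R) :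
  objective x - objective y <= \sum_K subgradient x K * (x K - y K).
Proof.
have -> : \sum_K subgradient x K * (x K - y K) =
   \sum_K x K * (boundary_size K)%:R - \sum_K y K * (boundary_size K)%:R
   - d%:R * (\sum_(v | coverage x v < 1) (coverage x v - coverage y v)).
  have -> : \sum_(v | coverage x v < 1) (coverage x v - coverage y v) =
      \sum_(K : {set G}) (x K - y K) * #|[set v in K | coverage x v < 1]|%:R.
    under eq_bigr do rewrite -sumrB.
    rewrite (exchange_big_dep predT) //=; apply: eq_bigr => K _.
    rewrite sumr_const -[LHS]mulr_natr; congr (_ * _%:R); apply: eq_card => v.
    by rewrite inE andbC.
  rewrite mulr_sumr -!sumrB; apply: eq_bigr => K _; rewrite /subgradient.
  by set a := #|_|%:R; set b := _%:R; ring.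
rewrite /objective.
have : \sum_v deficit x v - \sum_v deficit y v <=
    - \sum_(v | coverage x v < 1) (coverage x v - coverage y v).
  rewrite -sumrB -sumrN [leRHS]big_mkcond /=; apply: ler_sum => v _.
  rewrite /deficit; case: ltP => h.
    rewrite maxEle ifT; last by rewrite subr_ge0 ltW.
    have : 1 - coverage y v <= Num.max 0 (1 - coverage y v) by rewrite le_max lexx orbT.
    by move: (Num.max _ _) => m; lra.
  rewrite [X in X - _](_ : _ = 0); last by apply/max_idPl; rewrite subr_le0.
  by rewrite sub0r oppr_le0 le_max lexx.
move=> h; have := ler_wpM2l (ler0n R d) h; rewrite mulrBr mulrN; lra.
Qed.

Lemma descent_ge0 (G : sgraph) t (K : {set G}) : 0 <= descent t K.
Proof. by case: t => //= t; rewrite /descent_step; case: ifP => // _; rewrite le_max lexx. Qed.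

Lemma descent_kcluster (G : sgraph) t (K : {set G}) : ~~ kcluster k K -> descent t K = 0.
Proof. by case: t => //= t /negbTE h; rewrite /descent_step h. Qed.

Lemma deficit_ge0 (G : sgraph) (x : {set G} -> R) v : 0 <= deficit x v.
Proof. by rewrite le_max lexx. Qed.

(** A difference of two numbers that both lie between 0 and [d * k]. *)
Lemma subgradient_norm (G : sgraph) (x : {set G} -> R) (K : {set G}) :
  max_degree_le d G -> kcluster k K -> `|subgradient x K| <= (d * k)%:R.
Proof.
move=> dG /andP[Kk _].
have h1 : ((boundary_size K)%:R : R) <= (d * k)%:R.
  by rewrite ler_nat (leq_trans (boundary_size_le K dG)) // leq_mul2l Kk orbT.
have h2 : d%:R * #|[set v in K | coverage x v < 1]|%:R <= (d * k)%:R :> R.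
  rewrite -natrM ler_nat leq_mul2l (leq_trans _ Kk) ?orbT // subset_leq_card //.
  by apply/fintype.subsetP => v; rewrite inE => /andP[].
have h3 : 0 <= (boundary_size K)%:R :> R by [].
have h4 : 0 <= d%:R * #|[set v in K | coverage x v < 1]|%:R :> R by rewrite mulr_ge0.
by rewrite /subgradient ler_norml; apply/andP; split; lra.
Qed.

Lemma descent_le (G : sgraph) t (K : {set G}) :
  max_degree_le d G -> 0 <= eta -> descent t K <= t%:R * (eta * (d * k)%:R).
Proof.
move=> dG eta0; elim: t K => [|t IH] K; first by rewrite mul0r.
have b0 : 0 <= eta * (d * k)%:R by rewrite mulr_ge0.
rewrite /descent /= -/(descent t) /descent_step.
case: ifP => [cK|_]; last by rewrite mulr_ge0.
rewrite ge_max mulr_ge0 //= -natr1 mulrDl mul1r lerD // -mulrN ler_wpM2l //.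
by have := subgradient_norm (descent t) dG cK; rewrite ler_norml => /andP[h _]; rewrite lerNl.
Qed.

(** Bounds the number of subsets of a ball of radius [k]; every cluster through the centre is such a
    subset. *)
Definition kcluster_bound : nat := (2 ^ (d.+1 ^ k))%N.

Lemma card_kclusters (G : sgraph) (v : G) : max_degree_le d G ->
  (#|[set K : {set G} | (v \in K) && kcluster k K]| <= kcluster_bound)%N.
Proof.
move=> dG; apply: (@leq_trans #|powerset (ball_set v k)|).
  apply: subset_leq_card; apply/fintype.subsetP => K; rewrite inE powersetE => /andP[vK cK].
  exact: kcluster_sub cK vK.
by rewrite card_powerset leq_exp2l // card_ball_set.
Qed.

Definition sq_bound : R := kcluster_bound%:R * (d * k)%:R ^+ 2.

(** Each nonempty cluster is charged to its vertices, and a vertex is charged at most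
    [kcluster_bound] times. The empty cluster has subgradient 0. *)
Lemma sum_sq_subgradient (G : sgraph) (x : {set G} -> R) : max_degree_le d G ->
  \sum_(K : {set G} | kcluster k K) subgradient x K ^+ 2 <= #|G|%:R * sq_bound.
Proof.
move=> dG.
have sq0 : 0 <= (d * k)%:R ^+ 2 :> R by rewrite exprn_ge0.
apply: (@le_trans _ _ (\sum_(K : {set G} | kcluster k K) \sum_(v in K) (d * k)%:R ^+ 2)).
  apply: ler_sum => K cK; have [->|[v vK]] := set_0Vmem K.
    rewrite big_set0 /subgradient /boundary_size big_set0 (_ : [set _ in _ | _] = finset.set0).
      by rewrite finset.cards0 mulr0 subr0 expr0n.
    by apply/setP => v; rewrite !inE.
  rewrite (bigD1 v) //=; apply: (@le_trans _ _ ((d * k)%:R ^+ 2)).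
    by rewrite -real_normK ?num_real // lerXn2r ?nnegrE // subgradient_norm.
  by rewrite lerDl sumr_ge0.
rewrite (exchange_big_dep predT) //= -sum1_card natr_sum mulr_suml.
apply: ler_sum => v _; rewrite mul1r sumr_const -[leLHS]mulr_natr mulrC.
apply: ler_wpM2r => //; rewrite ler_nat; apply: leq_trans (card_kclusters v dG).
apply: subset_leq_card.
by apply/fintype.subsetP => K; rewrite !inE andbC.
Qed.

(** Expand the square of x - eta g - y and use [subgradientP] for the cross term. Truncating at 0
    only moves closer to [y], as [y] is nonnegative. *)
Lemma descent_step_dist (G : sgraph) (x y : {set G} -> R) : max_degree_le d G ->
    (forall K, 0 <= y K) -> (forall K, ~~ kcluster k K -> y K = 0) ->
    (forall K, ~~ kcluster k K -> x K = 0) -> 0 <= eta ->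
  \sum_K (descent_step x K - y K) ^+ 2 <=
  \sum_K (x K - y K) ^+ 2 - 2 * eta * (objective x - objective y)
    + eta ^+ 2 * (#|G|%:R * sq_bound).
Proof.
move=> dG y0 yc xc eta0.
apply: (@le_trans _ _ (\sum_K (x K - y K) ^+ 2
   - 2 * eta * (\sum_K subgradient x K * (x K - y K))
   + eta ^+ 2 * (\sum_(K : {set G} | kcluster k K) subgradient x K ^+ 2))).
  rewrite [X in _ ^+ 2 * X]big_mkcond /= !mulr_sumr -sumrB -big_split /=.
  apply: ler_sum => K _; rewrite /descent_step; case: ifP => cK; last first.
    by rewrite yc ?xc ?cK // subrr !mulr0 !expr0n /= subrr addr0.
  set g := subgradient x K; set a := x K; set b := y K.
  have -> : (a - b) ^+ 2 - 2 * eta * (g * (a - b)) + eta ^+ 2 * g ^+ 2 =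
    (a - eta * g - b) ^+ 2 by ring.
  have b0 : 0 <= b by exact: y0.
  case: (leP 0 (a - eta * g)) => // h; nra.
rewrite lerD //; last by rewrite ler_wpM2l ?sqr_ge0 // sum_sq_subgradient.
by rewrite lerD // lerN2 ler_wpM2l ?mulr_ge0 // subgradientP.
Qed.

(** If each of the first [T] iterates exceeded the target, every step would lower the squared
    distance to [y] by at least |G| delta^2 / [sq_bound], the optimum of 2 eta delta - eta^2
    [sq_bound] in eta, times |G|. Starting from at most |G|, the distance would become negative. *)
Lemma descent_converges (G : sgraph) (y : {set G} -> R) (delta : R) (T : nat) :
    max_degree_le d G -> (forall K, 0 <= y K) ->
    (forall K, ~~ kcluster k K -> y K = 0) ->
    \sum_K y K ^+ 2 <= #|G|%:R -> 0 < delta -> eta = delta / sq_bound ->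
    0 < sq_bound -> sq_bound < T%:R * delta ^+ 2 -> (0 < T)%N ->
  exists2 t, (t < T)%N & objective (@descent G t) <= objective y + delta * #|G|%:R.
Proof.
move=> dG y0 yc ysq delta0 etaE M0 TM T0.
have eta0 : 0 <= eta by rewrite etaE divr_ge0 // ltW.
have [G0|G0] := posnP #|G|.
  exists 0%N => //; rewrite G0 mulr0 addr0 /objective.
  have e (x : {set G} -> R) : objective x = 0.
    rewrite /objective [X in _ * X]big1 => [|v]; last first.
      by have := max_card (pred1 v); rewrite G0 card1.
    rewrite big1 ?mulr0 ?addr0 // => K _; rewrite (_ : boundary_size K = 0%N) ?mulr0 //.
    by rewrite /boundary_size big1 // => v; have := max_card (pred1 v); rewrite G0 card1.
  by have := e (descent 0); rewrite /objective => ->; have := e y; rewrite /objective => ->.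
apply: contrapT => H.
have hq t : (t <= T)%N ->
    \sum_K (@descent G t K - y K) ^+ 2 <= #|G|%:R * (1 - t%:R * (delta ^+ 2 / sq_bound)).
  elim: t => [_|t IH tT].
    (* The descent starts at 0, so the initial squared distance is that of [y] from 0. *)
    by rewrite mul0r subr0 mulr1; under eq_bigr do rewrite sub0r sqrrN.
  have ht : objective y + delta * #|G|%:R < objective (@descent G t).
    by rewrite ltNge; apply/negP => h; apply: H; exists t.
  apply: le_trans (descent_step_dist dG y0 yc (@descent_kcluster G t) eta0) _.
  have h := IH (ltnW tT).
  have h2 : 2 * eta * (delta * #|G|%:R) <= 2 * eta * (objective (@descent G t) - objective y).
    by rewrite ler_wpM2l ?mulr_ge0 //; lra.
  have -> : #|G|%:R * (1 - t.+1%:R * (delta ^+ 2 / sq_bound)) =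
    #|G|%:R * (1 - t%:R * (delta ^+ 2 / sq_bound)) - 2 * eta * (delta * #|G|%:R)
      + eta ^+ 2 * (#|G|%:R * sq_bound).
    by rewrite etaE -natr1; field; rewrite gt_eqF.
  lra.
have := le_trans (sumr_ge0 _ (fun K _ => sqr_ge0 (@descent G T K - y K))) (hq T (leqnn T)).
rewrite pmulr_rge0 ?ltr0n // subr_ge0 mulrA ler_pdivrMr // mul1r leNgt.
by rewrite TM.
Qed.

End Descent.

(** * Hyper-finiteness versus low cost *)

Lemma hyperfinite_competitor (R : realType) (d k : nat) (eps : R) (G : sgraph) :
  hyperfinite eps k G -> exists y : {set G} -> R,
    [/\ forall K, 0 <= y K, forall K, ~~ kcluster k K -> y K = 0,
        \sum_K y K ^+ 2 <= #|G|%:R & objective d y <= 2 * eps * #|G|%:R].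
Proof.
move=> [F [FE Fc Fk]].
pose H := graph_of_edges (edges G :\: F).
pose comp (v : G) : {set G} := @component H v.
pose P := [set comp v | v in G].
have compE u v : u \in comp v -> comp u = comp v.
  rewrite inE => h; apply/setP => w; rewrite !inE.
  by rewrite (same_connect (sym_connect_sym (@pair_adj_sym _ _)) h).
exists (fun K => (K \in P)%:R); split.
- by [].
- move=> K; case: imsetP => // -[v _ ->] /negP[].
  apply/andP; split; first exact: Fk.
  apply/forall_inP => u uv; rewrite -(compE _ _ uv).
  apply/fintype.subsetP => w; rewrite inE => /connectP[p hp ->].
  (* A simple path inside a component visits at most [k] vertices, so its length is less than [k].
     Thus components are clusters. *)
  case/shortenP: hp => q hq uq _.
  apply/ball_setP; exists q; split=> //.
    apply: leq_trans (Fk u); apply: leq_trans (leqnSn _) _.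
    rewrite -[(size q).+1]/(size (u :: q)) -(card_uniqP uq); apply: subset_leq_card.
    by apply/fintype.subsetP => a aq; rewrite inE; apply: (path_connect hq).
  apply: sub_path hq => a b; rewrite /= adj_del; by case/andP.
- apply: (@le_trans _ _ (#|P|%:R)); last by rewrite ler_nat leq_imset_card.
  rewrite -sum1_card natr_sum [leRHS]big_mkcond /=; apply: ler_sum => K _.
  by case: (K \in P); rewrite ?expr1n ?expr0n.
(* Components cover every vertex, so there is no deficit. An edge leaving a component lies in [F]
   and is counted at most once from each end, whence the factor 2. *)
- rewrite /objective [X in _ + _ * X]big1 ?mulr0 ?addr0; last first.
    move=> v _; apply/max_idPl; rewrite subr_le0 /coverage (bigD1 (comp v)) /=; last first.
      by rewrite inE.
    by rewrite imset_f // lerDl sumr_ge0.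
  have -> : \sum_K (K \in P)%:R * (boundary_size K)%:R =
      (\sum_(K in P) boundary_size K)%N%:R :> R.
    rewrite natr_sum [RHS]big_mkcond /=; apply: eq_bigr => K _.
    by case: (K \in P); rewrite ?mul1r ?mul0r.
  apply: (@le_trans _ _ (#|F| * 2)%:R); last by rewrite natrM mulrC -mulrA ler_pM2l.
  have -> : (\sum_(K in P) boundary_size K =
      \sum_(u in G) #|[set w | adj u w & w \notin comp u]|)%N.
    rewrite [RHS](partition_big_imset comp) /=; apply: eq_bigr => K /imsetP[v _ ->].
    apply: eq_big => u; last by move=> /compE->.
    by apply/idP/eqP => [/compE//|<-]; rewrite inE.
  rewrite ler_nat -card_directed_edges // -sum1_card.
  rewrite (partition_big (fun p : G * G => p.1) (mem G)) //=.
  apply: leq_sum => u _; rewrite sum1dep_card.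
  rewrite -(card_imset [set w | adj u w & _] (f := pair u)); last by move=> ? ? [].
  apply: subset_leq_card; apply/fintype.subsetP => _ /imsetP[w + ->].
  rewrite !inE /= => /andP[uw nw]; rewrite eqxx andbT.
  by apply: contraNT nw => nF; apply: connect1; rewrite /= adj_del uw.
Qed.

(** Adding the deficit of each vertex to the weight of its singleton gives a genuine fractional
    cover. A singleton has boundary at most [d], so the deficit term of [objective] pays for
    this. *)
Lemma low_objective_partition (R : realType) (d k : nat) (G : sgraph)
    (x : {set G} -> R) (C : R) :
    (0 < d)%N -> (0 < k)%N -> max_degree_le d G ->
    (forall K, 0 <= x K) -> (forall K, ~~ kcluster k K -> x K = 0) ->
    0 < C -> objective d x <= C ->
  exists F : {set {set G}}, [/\ F \subset edges G,
    #|F|%:R <= greedy_cost C d%:R #|G|%:R &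
    forall v : graph_of_edges (edges G :\: F), (#|component v| <= k)%N].
Proof.
move=> d0 k0 dG x0 xc C0 xC.
pose s (K : {set G}) := \sum_(v | K == [set v]) deficit x v.
have s0 K : 0 <= s K by apply: sumr_ge0 => v _; exact: deficit_ge0.
pose x' (K : {set G}) := x K + s K.
have [F [FE Fc Fk]] : exists F : {set {set G}}, [/\ F \subset edges G,
    #|F|%:R <= greedy_cost C d%:R #|[set: G]|%:R &
    forall v, v \in [set: G] ->
      (#|@component (graph_of_edges (edges G :\: F)) v| <= k)%N].
  apply: (@greedy_partition R G d k x') => //.
  - by move=> K; rewrite addr_ge0.
  - move=> K; rewrite /x' /s; have [cK _|cK] := boolP (kcluster k K).
      by case/andP: cK.
    rewrite xc // add0r; apply: contraNT; rewrite -ltnNge => kK.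
    rewrite big1 // => v /eqP Kv; move: kK; rewrite Kv cards1 ltnS leqn0.
    by case: (k) k0.
  - move=> v; rewrite big_split /= -/(coverage x v).
    apply: (@le_trans _ _ (coverage x v + deficit x v)).
      by rewrite -lerBlDl /deficit le_max lexx orbT.
    rewrite lerD2l (bigD1 [set v]) ?finset.set11 //= ler_wpDr ?sumr_ge0 //.
    rewrite /s (bigD1 v) //= lerDl sumr_ge0 // => u _; exact: deficit_ge0.
  - apply: le_trans xC; rewrite /objective /x'.
    under eq_bigr do rewrite mulrDl.
    rewrite big_split /= lerD2l /s.
    under eq_bigr do rewrite mulr_suml.
    rewrite (exchange_big_dep predT) //= mulr_sumr; apply: ler_sum => v _.
    rewrite (big_pred1 [set v]) // mulrC ler_wpM2r ?deficit_ge0 // ler_nat.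
    by have := boundary_size_le [set v] dG; rewrite cards1 muln1.
by exists F; split=> //; [rewrite -cardsT|move=> v; apply: Fk; rewrite inE].
Qed.

Lemma hyperfinite_all_edges (R : realType) (d k : nat) (delta : R) (G : sgraph) :
  (0 < k)%N -> max_degree_le d G -> d%:R / 2 <= delta -> hyperfinite delta k G.
Proof.
move=> k0 dG dd; exists (edges G); split=> //.
- have h : (#|edges G| * 2 <= d * #|G|)%N.
    rewrite -card_directed_edges // -sum1_card mulnC -sum_nat_const.
    rewrite (partition_big (fun p : G * G => p.1) (mem G)) //=.
    apply: leq_sum => u _; rewrite sum1dep_card; apply: leq_trans (dG u).
    rewrite -(card_imset [set w | adj u w] (f := pair u)); last by move=> ? ? [].
    apply: subset_leq_card; apply/fintype.subsetP => -[a b].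
    rewrite finset.in_set => /andP[]; rewrite finset.in_set /= mem_edges2.
    by move=> ab /eqP <-; apply/imsetP; exists b; rewrite ?inE.
  apply: le_trans (_ : d%:R / 2 * #|G|%:R <= _); last by rewrite ler_wpM2r.
  rewrite mulrAC ler_pdivlMr // -!natrM ler_nat //.
- move=> v; apply: leq_trans k0; rewrite -(cards1 v); apply: subset_leq_card.
  apply: component_del_boundary; last exact: set11.
  by move=> u w uw _ _; rewrite mem_edges2.
Qed.

Lemma hyperfinite_empty (R : realType) (k : nat) (delta : R) (G : sgraph) :
  #|G| = 0%N -> hyperfinite delta k G.
Proof.
move=> G0; exists finset.set0.
rewrite finset.sub0set finset.cards0 G0 mulr0 lexx; split=> // v.
by have := max_card (pred1 (v : G)); rewrite G0 card1.
Qed.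

(** With C = 4 eps |G| the greedy cost per vertex is 4 eps (1 + ln z) for z = d / (4 eps), and 1 +
    ln z <= ln (16 z) = ln (4 d / eps). *)
Lemma low_objective_hyperfinite (R : realType) (d k : nat) (eps : R) (G : sgraph)
    (x : {set G} -> R) :
    (0 < d)%N -> (0 < k)%N -> 0 < eps -> eps < d%:R / 2 -> max_degree_le d G ->
    (forall K, 0 <= x K) -> (forall K, ~~ kcluster k K -> x K = 0) ->
    objective d x <= 4 * eps * #|G|%:R ->
  hyperfinite (4 * eps * ln (4 * d%:R / eps)) k G.
Proof.
move=> d0 k0 e0 ed dG x0 xc xC.
have d0' : 0 < d%:R :> R by rewrite ltr0n.
have hln (z : R) : 2^-1 <= z -> 1 + ln z <= ln (16 * z).
  move=> hz; rewrite (_ : 16 = 4 * 4); last by ring.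
  have l4 : 3 / 4 <= ln 4 :> R by apply: le_trans (ln_ge1BV _); lra.
  by rewrite !lnM ?posrE //; lra.
have z0 : 4 * d%:R / eps = 16 * (d%:R / (4 * eps)) by field; rewrite gt_eqF.
have hz : 2^-1 <= d%:R / (4 * eps) by rewrite ler_pdivlMr; lra.
have hlz := hln _ hz.
(* In the linear range all edges are deleted: ln (4 d / eps) >= 1 - eps / (4 d) >= 7/8, and 2 eps >=
   d / 2. *)
have [h|h] := leP d%:R (4 * eps).
  apply: hyperfinite_all_edges k0 dG _.
  have := ln_ge1BV (x := 4 * d%:R / eps); rewrite divr_gt0 ?mulr_gt0 // invf_div => /(_ isT) hl.
  have hq : eps / (4 * d%:R) <= 1 / 8 by rewrite ler_pdivrMr ?mulr_gt0 //; lra.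
  apply: (@le_trans _ _ (4 * eps * (1 / 2))); first by lra.
  by rewrite ler_wpM2l //; lra.
have [G0|G0] := posnP #|G|.
  exact: hyperfinite_empty.
have n0 : 0 < #|G|%:R :> R by rewrite ltr0n.
have C0 : 0 < 4 * eps * #|G|%:R by rewrite !mulr_gt0.
have [F [FE Fc Fk]] := low_objective_partition d0 k0 dG x0 xc C0 xC.
exists F; split=> //; apply: le_trans Fc _.
rewrite /greedy_cost [#|G|%:R * _]mulrC ler_pM2r // (leNgt d%:R) h /= z0.
have -> : d%:R * #|G|%:R / (4 * eps * #|G|%:R) = d%:R / (4 * eps) :> R.
  by field; rewrite !gt_eqF.
by rewrite [leLHS]mulrAC ler_wpM2r // ler_wpM2l //; lra.
Qed.

(** * Isomorphisms of balls and locality of the descent *)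

Definition ball_iso (G G' : sgraph) (phi : G -> G') (v : G) (r : nat) : Prop :=
  [/\ {in ball_set v r &, injective phi},
      {in ball_set v r &, forall x y, adj (phi x) (phi y) = adj x y} &
      phi @: ball_set v r = ball_set (phi v) r].

Lemma mem_imset_in (aT rT : finType) (f : aT -> rT) (D A : {set aT}) (x : aT) :
  {in D &, injective f} -> A \subset D -> x \in D -> (f x \in f @: A) = (x \in A).
Proof.
move=> fI /fintype.subsetP AD xD; apply/imsetP/idP => [[y yA /fI->]|xA] //; last by exists x.
exact: AD.
Qed.

Section BallIso.
Variables (G G' : sgraph) (phi : G -> G').

Lemma ball_iso_mem (v y : G) (r s : nat) : ball_iso phi v r -> (s <= r)%N ->
  y \in ball_set v s -> phi y \in ball_set (phi v) s.
Proof.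
move=> [_ fA _]; elim: s y => [|s IH] y sr.
  by rewrite !ball_set0 => /finset.set1P->; rewrite finset.set11.
move=> ys; case: (ball_setS ys) => [|[z zs zy]].
  by move=> /(IH _ (ltnW sr)); apply: fintype.subsetP; exact: ball_set_mono.
have yr := fintype.subsetP (ball_set_mono v sr) _ ys.
have zr := fintype.subsetP (ball_set_mono v (ltnW sr)) _ zs.
rewrite -addn1; apply: ball_set_trans (IH _ (ltnW sr) zs) _; apply: ball_set_adj.
by rewrite fA.
Qed.

(** Induction on [s]. For surjectivity, a neighbour of [phi z] is still within [r] of [phi v], so it
    has a preimage in the large ball, adjacent to [z] because [phi] reflects adjacency there. *)
Lemma ball_iso_imset (v u : G) (r a s : nat) : ball_iso phi v r ->
  u \in ball_set v a -> (a + s <= r)%N -> phi @: ball_set u s = ball_set (phi u) s.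
Proof.
move=> hphi ua; have [fI fA fB] := hphi.
elim: s => [|s IH] asr; first by rewrite !ball_set0 imset_set1.
have asr' : (a + s <= r)%N by apply: leq_trans asr; rewrite leq_add2l.
have inr w : w \in ball_set u s.+1 -> w \in ball_set v r.
  by move=> h; apply: (fintype.subsetP (ball_set_mono _ asr)); exact: ball_set_trans h.
have inr' w : w \in ball_set u s -> w \in ball_set v r.
  by move=> h; apply: inr; apply: fintype.subsetP h; exact: ball_set_mono.
apply/setP => w; apply/imsetP/idP => [[y ys ->]|ws].
  case: (ball_setS ys) => [h|[z zs zy]].
    apply: (fintype.subsetP (ball_set_mono _ (leqnSn s))).
    by rewrite -IH // imset_f.
  rewrite -addn1; apply: (@ball_set_trans _ _ _ _ (phi z)); first by rewrite -IH // imset_f.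
  by apply: ball_set_adj; rewrite fA // ?(inr' z) ?(inr y).
case: (ball_setS ws) => [|[z' + zw]].
  rewrite -IH // => /imsetP[y ys ->]; exists y => //.
  by apply: fintype.subsetP ys; exact: ball_set_mono.
rewrite -IH // => /imsetP[z zs zE].
have : w \in ball_set (phi v) r.
  apply: (fintype.subsetP (ball_set_mono _ asr)); apply: ball_set_trans ws.
  by apply: (ball_iso_mem hphi _ ua); apply: leq_trans asr; rewrite leq_addr.
rewrite -fB => /imsetP[y yr yE]; exists y => //; rewrite -addn1.
apply: (ball_set_trans zs); apply: ball_set_adj.
by rewrite -fA ?(inr' z) // -zE -yE.
Qed.

Lemma ball_iso_sub (v u : G) (r a s : nat) : ball_iso phi v r ->
  u \in ball_set v a -> (a + s <= r)%N -> ball_iso phi u s.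
Proof.
move=> hphi ua asr; have [fI fA fB] := hphi.
have sub w : w \in ball_set u s -> w \in ball_set v r.
  by move=> h; apply: (fintype.subsetP (ball_set_mono _ asr)); exact: ball_set_trans h.
split; last exact: (ball_iso_imset hphi ua asr).
- by move=> x y xs ys; apply: fI; exact: sub.
- by move=> x y xs ys; apply: fA; exact: sub.
Qed.

(** Radius [k + k]: the test looks at balls of radius [k] around points of [K], themselves within
    [k] of [u]. *)
Lemma ball_iso_kcluster (u : G) (k r : nat) (K : {set G}) :
  ball_iso phi u r -> (k + k <= r)%N -> K \subset ball_set u k ->
  kcluster k (phi @: K) = kcluster k K.
Proof.
move=> hphi kr Kk; have [fI _ _] := hphi.
have kr' : (k <= r)%N by apply: leq_trans kr; rewrite leq_addr.
have Kr w : w \in K -> w \in ball_set u r.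
  by move=> /(fintype.subsetP Kk)/(fintype.subsetP (ball_set_mono _ kr')).
rewrite /kcluster card_in_imset; last by move=> a b aK bK; apply: fI; exact: Kr.
congr (_ && _).
have sub a : a \in K -> (phi @: K \subset ball_set (phi a) k) = (K \subset ball_set a k).
  move=> aK; have ak := fintype.subsetP Kk _ aK.
  rewrite -(ball_iso_imset hphi ak kr); apply/idP/idP; last exact: imsetS.
  move=> /fintype.subsetP h; apply/fintype.subsetP => b bK.
  rewrite -(mem_imset_in fI _ (Kr _ bK)) ?h ?imset_f //.
  apply/fintype.subsetP => w wk; apply: (fintype.subsetP (ball_set_mono _ kr)).
  exact: ball_set_trans wk.
apply/forall_inP/forall_inP => h a; first by move=> aK; rewrite -sub // h // imset_f.
by move=> /imsetP[b bK ->]; rewrite sub // h.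
Qed.

Lemma ball_iso_boundary_size (u : G) (k r : nat) (K : {set G}) :
  ball_iso phi u r -> (k + 1 <= r)%N -> K \subset ball_set u k ->
  boundary_size (phi @: K) = boundary_size K.
Proof.
move=> hphi kr Kk; have [fI fA fB] := hphi.
have kr' : (k <= r)%N by apply: leq_trans kr; rewrite leq_addr.
have Kr w : w \in K -> w \in ball_set u r.
  by move=> /(fintype.subsetP Kk)/(fintype.subsetP (ball_set_mono _ kr')).
have KR : K \subset ball_set u r by apply/fintype.subsetP.
have nr a w : a \in K -> adj a w -> w \in ball_set u r.
  move=> aK aw; apply: (fintype.subsetP (ball_set_mono _ kr)).
  by apply: ball_set_trans (ball_set_adj aw); exact: (fintype.subsetP Kk).
rewrite /boundary_size big_imset /=; last by move=> a b aK bK; apply: fI; exact: Kr.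
apply: eq_bigr => a aK.
rewrite -[RHS](card_in_imset (f := phi)); last first.
  by move=> b c; rewrite !inE => /andP[ab _] /andP[ac _]; apply: fI; exact: nr aK _.
apply: eq_card => w; rewrite inE; apply/andP/imsetP => [[aw nw]|[b + ->]].
  have : w \in phi @: ball_set a 1.
    rewrite (ball_iso_imset hphi (fintype.subsetP Kk _ aK) kr); exact: ball_set_adj.
  move=> /imsetP[b /ball_setS].
  rewrite ball_set0 => -[/finset.set1P->|[_ /finset.set1P-> ab]] e; subst w.
    by move: aw; rewrite adj_irrefl.
  by exists b => //; rewrite inE ab; apply: contra nw; exact: imset_f.
rewrite inE => /andP[ab nb].
have br := nr _ _ aK ab; have ar := Kr _ aK.
by split; [rewrite fA|rewrite (mem_imset_in fI KR)].
Qed.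

(** Only clusters contribute, and those through [u] lie in its ball of radius [k], on whose subsets
    [phi] induces a bijection. *)
Lemma ball_iso_sum (R : realType) (u : G) (k r : nat)
    (F : {set G} -> R) (F' : {set G'} -> R) :
    ball_iso phi u r -> (k <= r)%N ->
    (forall K, ~~ kcluster k K -> F K = 0) -> (forall K, ~~ kcluster k K -> F' K = 0) ->
    (forall K : {set G}, u \in K -> K \subset ball_set u k -> F' (phi @: K) = F K) ->
  \sum_(K : {set G'} | phi u \in K) F' K = \sum_(K : {set G} | u \in K) F K.
Proof.
move=> hphi kr FC FC' FE; have [fI fA fB] := hphi.
have fB' : phi @: ball_set u k = ball_set (phi u) k.
  exact: ball_iso_imset (ball_root_subproof u 0) kr.
have small (H : sgraph) (v : H) (f : {set H} -> R) :
    (forall K, ~~ kcluster k K -> f K = 0) ->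
    \sum_(K : {set H} | v \in K) f K =
    \sum_(K in [set K : {set H} | (v \in K) && (K \subset ball_set v k)]) f K.
  move=> f0; rewrite [RHS]big_mkcond [LHS]big_mkcond /=; apply: eq_bigr => K _.
  rewrite inE; case: (boolP (v \in K)) => //= vK; case: ifP => // sK.
  by apply: f0; apply: contraFN sK => /kcluster_sub; exact.
rewrite !small //.
have uk : u \in ball_set u k := ball_root_subproof u k.
have sub_r (K : {set G}) : K \subset ball_set u k -> K \subset ball_set u r.
  by move=> h; apply: fintype.subset_trans h (ball_set_mono _ kr).
have ur : u \in ball_set u r := ball_root_subproof u r.
rewrite (_ : [set K : {set G'} | _] =
  [set phi @: (K : {set G}) | K in [set K : {set G} | (u \in K) && (K \subset ball_set u k)]]).
  rewrite big_imset /=.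
    by apply: eq_bigr => K; rewrite inE => /andP[uK Kk]; exact: FE.
  move=> K L; rewrite !inE => /andP[_ Kk] /andP[_ Lk] E.
  have KL (A B : {set G}) : A \subset ball_set u k -> B \subset ball_set u k ->
      phi @: A = phi @: B -> A \subset B.
    move=> hA hB AB; have Ak := sub_r _ hA; have Bk := sub_r _ hB; apply/fintype.subsetP => a aA.
    by rewrite -(mem_imset_in fI Bk (fintype.subsetP Ak _ aA)) -AB imset_f.
  by apply/eqP; rewrite finset.eqEsubset; apply/andP; split; apply: KL.
apply/setP => K'; rewrite inE; apply/andP/imsetP => [[uK Kk]|[K]].
  exists [set x in ball_set u k | phi x \in K'].
    rewrite finset.in_set finset.in_set uk uK /=.
    by apply/fintype.subsetP => x; rewrite finset.in_set => /andP[].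
  apply/setP => w; apply/idP/imsetP => [wK|[x]].
    have := fintype.subsetP Kk _ wK; rewrite -fB' => /imsetP[x xk xE].
    by exists x => //; rewrite finset.in_set xk -xE wK.
  by rewrite finset.in_set => /andP[_ h] ->.
rewrite inE => /andP[uK Kk] ->; rewrite imset_f //; split=> //.
by rewrite -fB'; exact: imsetS.
Qed.

End BallIso.

(** A step at [K] reads the coverage at the vertices of [K], hence weights of clusters through them.
    Recentring the ball at such a vertex costs [k] per step; the remaining [k + k + 1] serves the
    cluster test and the boundary. *)
Lemma descent_local (R : realType) (d k t : nat) (eta : R) (G G' : sgraph)
    (phi : G -> G') (u : G) (r : nat) (K : {set G}) :
  ball_iso phi u r -> (t * k + (k + k + 1) <= r)%N -> K \subset ball_set u k ->
  descent d k eta t (phi @: K) = descent d k eta t K.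
Proof.
elim: t u r K => [|t IH] u r K //= hphi tr Kk.
have tr' : (t * k + (k + k + 1) + k <= r)%N by move: tr; rewrite mulSn; lia.
have kkr : (k + k <= r)%N by lia.
have k1r : (k + 1 <= r)%N by lia.
rewrite -/(descent d k eta t) -/(descent d k eta t) /descent_step (ball_iso_kcluster hphi kkr Kk).
have tr'' : (t * k + (k + k + 1) <= r)%N by lia.
case: ifP => // _; rewrite (IH u r K hphi tr'' Kk).
congr (Num.max 0 (_ - _ * _)); rewrite /subgradient (ball_iso_boundary_size hphi k1r Kk).
congr (_ - _ * _%:R).
have cov a : a \in K ->
    coverage (descent d k eta t) (phi a) = coverage (descent d k eta t) a.
  move=> aK; have ak := fintype.subsetP Kk _ aK.
  have ha : ball_iso phi a (r - k) by apply: ball_iso_sub hphi ak _; lia.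
  apply: (ball_iso_sum (k := k) ha).
  - by lia.
  - exact: descent_kcluster.
  - exact: descent_kcluster.
  - by move=> L _ Lk; apply: (IH _ _ _ ha _ Lk); lia.
have [fI _ _] := hphi.
have Kr : K \subset ball_set u r.
  by apply: fintype.subset_trans Kk (ball_set_mono _ _); lia.
rewrite -[RHS](card_in_imset (f := phi)); last first.
  move=> a b; rewrite !inE => /andP[aK _] /andP[bK _].
  by apply: fI; exact: (fintype.subsetP Kr).
apply: eq_card => w; rewrite inE; apply/andP/imsetP => [[/imsetP[a aK ->] h]|[a + ->]].
  by exists a => //; rewrite inE aK -cov.
by rewrite inE => /andP[aK h]; rewrite imset_f // cov.
Qed.

(** * The objective as a sum of local costs *)

Section LocalCost.
Variables (R : realType) (d k : nat).

(* [x K * boundary_size K] is split evenly among the vertices of [K]. *)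
Definition local_cost (G : sgraph) (x : {set G} -> R) (v : G) : R :=
  \sum_(K : {set G} | v \in K) x K * (boundary_size K)%:R / #|K|%:R
    + d%:R * deficit x v.

Lemma sum_local_cost (G : sgraph) (x : {set G} -> R) :
  \sum_v local_cost x v = objective d x.
Proof.
rewrite big_split /= -mulr_sumr; congr (_ + _).
rewrite (exchange_big_dep predT) //=; apply: eq_bigr => K _.
(* The empty set has no vertex to carry its share, but its boundary is 0. *)
rewrite sumr_const; have [->|K0] := eqVneq K finset.set0.
  by rewrite finset.cards0 mulr0n /boundary_size big_set0 mulr0.
by rewrite -[LHS]mulr_natr divfK // pnatr_eq0 cards_eq0.
Qed.

Lemma local_cost_local (eta : R) (t : nat) (G G' : sgraph)
    (phi : G -> G') (u : G) (r : nat) :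
  ball_iso phi u r -> (t * k + (k + k + 1) <= r)%N ->
  local_cost (@descent R d k eta G' t) (phi u) = local_cost (@descent R d k eta G t) u.
Proof.
move=> hphi tr; have kr : (k <= r)%N by lia.
have k1r : (k + 1 <= r)%N by lia.
have [fI _ _] := hphi.
congr (_ + _ * Num.max 0 (1 - _)).
  apply: (ball_iso_sum hphi kr); try by move=> K cK; rewrite descent_kcluster // !mul0r.
  move=> K uK Kk; rewrite (descent_local _ _ hphi tr Kk) (ball_iso_boundary_size hphi k1r Kk).
  rewrite card_in_imset // => a b aK bK; have sub := ball_set_mono u kr.
  by apply: fI; apply: (fintype.subsetP sub); exact: (fintype.subsetP Kk).
apply: (ball_iso_sum hphi kr); try exact: descent_kcluster.
by move=> K uK Kk; rewrite (descent_local _ _ hphi tr Kk).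
Qed.

Definition local_cost_bound (eta : R) (t : nat) : R :=
  (kcluster_bound d k)%:R * (t%:R * (eta * (d * k)%:R) * (d * k)%:R) + d%:R.

(** At most [kcluster_bound] clusters contain [u], each with weight bounded by [descent_le] and
    boundary at most [d * k]; a deficit is at most 1. *)
Lemma local_cost_le (eta : R) (t : nat) (G : sgraph) (u : G) :
  max_degree_le d G -> 0 <= eta ->
  `|local_cost (@descent R d k eta G t) u| <= local_cost_bound eta t.
Proof.
move=> dG eta0.
have x0 (K : {set G}) : 0 <= descent d k eta t K := descent_ge0 d k eta t K.
have c0 : 0 <= \sum_(K : {set G} | u \in K) descent d k eta t K :> R by rewrite sumr_ge0.
have d0 : 0 <= deficit (descent d k eta t) u := deficit_ge0 _ u.
rewrite ger0_norm; last first.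
  by rewrite addr_ge0 ?mulr_ge0 // sumr_ge0 // => K _; rewrite divr_ge0 ?mulr_ge0.
rewrite lerD //; last first.
  by rewrite ler_piMr // /deficit ge_max ler01 gerBl.
have b0 : 0 <= t%:R * (eta * (d * k)%:R) * (d * k)%:R by rewrite !mulr_ge0.
apply: (@le_trans _ _ (\sum_(K in [set K : {set G} | (u \in K) && kcluster k K])
    t%:R * (eta * (d * k)%:R) * (d * k)%:R)); last first.
  rewrite sumr_const -[leLHS]mulr_natr mulrC ler_wpM2r // ler_nat.
  exact: card_kclusters.
rewrite big_mkcond [leRHS]big_mkcond /=; apply: ler_sum => K _; rewrite inE.
case: ifP => //= uK; case: ifP => cK; last by rewrite descent_kcluster ?cK // !mul0r.
have K1 : 1 <= #|K|%:R :> R by rewrite ler1n card_gt0; apply/set0Pn; exists u.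
rewrite ler_pdivrMr; last exact: lt_le_trans K1.
apply: (@le_trans _ _ (t%:R * (eta * (d * k)%:R) * (d * k)%:R)); last by rewrite ler_peMr.
apply: ler_pM => //; first exact: descent_le.
rewrite ler_nat (leq_trans (boundary_size_le K dG)) // leq_mul2l.
by case/andP: cK => ->; rewrite orbT.
Qed.

End LocalCost.

(** Trades a map between subtypes for one on all vertices, under which images of vertex sets are
    easy to form. *)
Lemma rooted_iso_ball_iso (G G' : sgraph) (v : G) (v' : G') (r : nat) :
  rooted_iso (rooted_ball v r) (rooted_ball v' r) ->
  exists2 phi : G -> G', phi v = v' & ball_iso phi v r.
Proof.
move=> [f [[g fK gK] fA fv]].
(* The root [v'] is the default value outside the ball, where [ball_iso] imposes nothing. *)
pose phi (u : G) : G' := if insub u is Some z then val (f z) else v'.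
have phiE (u : G) (hu : u \in ball_set v r) : phi u = val (f (exist _ u hu)).
  by rewrite /phi insubT.
have phiv : phi v = v'.
  rewrite (phiE _ (ball_root_subproof v r)).
  exact: (congr1 val fv).
exists phi => //; split.
- move=> x y xr yr; rewrite !phiE => /val_inj /(can_inj fK) /(congr1 val) /=.
  by [].
- by move=> x y xr yr; rewrite !phiE; have := fA (exist _ x xr) (exist _ y yr).
- rewrite phiv; apply/setP => w; apply/imsetP/idP => [[x xr ->]|wr].
    by rewrite (phiE _ xr); exact: valP (f _).
  exists (val (g (exist _ w wr))); first exact: valP (g _).
  rewrite (phiE _ (valP (g (exist _ w wr)))).
  rewrite (_ : exist _ _ _ = g (exist _ w wr)) ?gK //; exact: val_inj.
Qed.

(** * Isomorphism types of balls and ball statistics *)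

Lemma rooted_graph_type_ex (X : rooted_graph) :
  exists H : rooted_graph_type, rooted_iso X (rooted_graph_of_type H).
Proof.
pose E := [set enum_rank @: (e : {set X}) | e in edges X].
pose c : rcode := Tagged (fun n : nat => ({set {set 'I_n}} * 'I_n)%type)
  (E, enum_rank (basepoint X)).
exists (\pi_rooted_graph_type c)%qT.
apply: (@rooted_iso_trans _ (rooted_graph_of_code c)).
  exists (enum_rank : X -> 'I_#|X|); split=> //.
  move=> x y; rewrite /= /pair_adj (inj_eq enum_rank_inj).
  have -> : [set enum_rank x; enum_rank y] = enum_rank @: [set x; y].
    by rewrite imsetU1 imset_set1.
  rewrite mem_imset; last by apply: imset_inj; exact: enum_rank_inj.
  by rewrite mem_edges2; case: eqVneq => // ->; rewrite adj_irrefl.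
have : rcode_iso c (repr (\pi_rooted_graph_type c)%qT).
  by apply/eqmodP; rewrite reprK.
by move=> /asboolP.
Qed.

Lemma rooted_graph_type_inj (H H' : rooted_graph_type) :
  rooted_iso (rooted_graph_of_type H) (rooted_graph_of_type H') -> H = H'.
Proof. by move=> h; rewrite -[H]reprK -[H']reprK; apply/eqmodP/asboolP. Qed.

Definition ball_type (r : nat) (G : sgraph) (v : G) : rooted_graph_type :=
  projT1 (cid (rooted_graph_type_ex (rooted_ball v r))).

Lemma ball_typeP (r : nat) (G : sgraph) (v : G) (H : rooted_graph_type) :
  rooted_iso (rooted_ball v r) (rooted_graph_of_type H) <-> ball_type r v = H.
Proof.
rewrite /ball_type; case: cid => /= H' h; split=> [h'|<- //].
by apply: rooted_graph_type_inj; apply: rooted_iso_trans h'; exact: rooted_iso_sym.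
Qed.

Lemma ball_type_iso (r : nat) (G G' : sgraph) (v : G) (v' : G') :
  ball_type r v = ball_type r v' -> rooted_iso (rooted_ball v r) (rooted_ball v' r).
Proof.
move=> /ball_typeP h; apply: rooted_iso_trans h _; apply: rooted_iso_sym.
exact/ball_typeP.
Qed.

(** Group the vertices by ball type. The list [s] may contain types absent from [G], so that two
    graphs can share one list. *)
Lemma local_average (R : realType) (r : nat) (G : sgraph) (s : seq rooted_graph_type)
    (h : G -> R) (g : rooted_graph_type -> R) :
    uniq s -> (forall v : G, ball_type r v \in s) -> (forall v, h v = g (ball_type r v)) ->
  (\sum_v h v) / #|G|%:R = \sum_(H <- s) g H * mu R r G (rooted_graph_of_type H).
Proof.
move=> us sG hg; rewrite /mu; under [RHS]eq_bigr do rewrite mulrA.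
rewrite -mulr_suml; congr (_ / _).
transitivity (\sum_(v : G) \sum_(H <- s | ball_type r v == H) g H).
  apply: eq_bigr => v _; rewrite hg -big_filter.
  rewrite (_ : [seq _ <- _ | _] = [:: ball_type r v]) ?big_seq1 //.
  by rewrite (eq_filter (a2 := pred1 (ball_type r v))) ?filter_pred1_uniq // => H; exact: eq_sym.
rewrite (exchange_big_dep predT) //=; apply: eq_bigr => H _.
rewrite sumr_const -[LHS]mulr_natr; congr (_ * _%:R); apply: eq_card => v.
rewrite [RHS]finset.in_set; transitivity (ball_type r v == H); first by [].
by apply/eqP/asboolP => /ball_typeP.
Qed.

(** [L] factors through a function of ball types bounded by [b]. The difference of averages is then
    at most [b] times a finite partial sum of [rho]. *)
Lemma rho_ge (R : realType) (r : nat) (L : forall G : sgraph, G -> R) (b : R)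
    (G G' : sgraph) :
    (forall (H H' : sgraph) (v : H) (v' : H'),
       rooted_iso (rooted_ball v r) (rooted_ball v' r) -> L H v = L H' v') ->
    (forall v : G, `|L G v| <= b) -> (forall v : G', `|L G' v| <= b) -> 0 <= b ->
  ((`|(\sum_v L G v) / #|G|%:R - (\sum_v L G' v) / #|G'|%:R|)%:E
    <= b%:E * rho R r G G')%E.
Proof.
move=> Liso Lb Lb' b0.
(* The value of [L] at any vertex of [G] or [G'] with ball type [H], and 0 if there is none; by
   [Liso] the choice of vertex does not matter. *)
pose g (H : rooted_graph_type) : R :=
  if pselect (exists v : G, ball_type r v = H) is left e then L G (projT1 (cid e))
  else if pselect (exists v : G', ball_type r v = H) is left e then L G' (projT1 (cid e))
  else 0.
have gG v : L G v = g (ball_type r v).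
  rewrite /g; case: pselect => [e|]; last by move=> []; exists v.
  by case: cid => /= u hu; apply: Liso; exact/ball_type_iso.
have gG' v : L G' v = g (ball_type r v).
  rewrite /g; case: pselect => [e|_].
    by case: cid => /= u hu; apply: Liso; exact/ball_type_iso.
  case: pselect => [e|]; last by move=> []; exists v.
  by case: cid => /= u hu; apply: Liso; exact/ball_type_iso.
have gb H : `|g H| <= b.
  by rewrite /g; case: pselect => [e|_] //; case: pselect => [e|_] //; rewrite normr0.
pose s := undup ([seq ball_type r v | v : G] ++ [seq ball_type r v | v : G']).
have us : uniq s := undup_uniq _.
have sG (v : G) : ball_type r v \in s.
  by rewrite mem_undup mem_cat; apply/orP; left; apply: map_f; rewrite mem_enum.
have sG' (v : G') : ball_type r v \in s.
  by rewrite mem_undup mem_cat; apply/orP; right; apply: map_f; rewrite mem_enum.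
rewrite (local_average us sG gG) (local_average us sG' gG') -sumrB.
apply: (@le_trans _ _ (b%:E * (\sum_(H <- s) `|mu R r G (rooted_graph_of_type H)
    - mu R r G' (rooted_graph_of_type H)|)%:E)%E).
  rewrite -EFinM lee_fin mulr_sumr; apply: le_trans (ler_norm_sum _ _ _) _.
  by apply: ler_sum => H _; rewrite -mulrBr normrM ler_wpM2r.
apply: lee_wpmul2l; first by rewrite lee_fin.
apply: esum_ge; exists [set` s]%classic; first by split=> //; exact: finite_seq.
by rewrite -fsbig_seq // sumEFin.
Qed.

Theorem theorem3 (R : realType) (d k : nat) (eps : R)
    (d_gt0 : (0 < d)%N) (k_gt0 : (0 < k)%N) (eps_gt0 : 0 < eps)
    (eps_large : d%:R / 2 <= eps ->
       d%:R / 2 <= 4 * eps * ln (4 * d%:R / eps)) :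
  let A := fun G : sgraph => hyperfinite eps k G /\ max_degree_le d G in
  let B := fun G : sgraph =>
    max_degree_le d G /\ ~ hyperfinite (4 * eps * ln (4 * d%:R / eps)) k G in
  exists r : nat, (0 < r)%N /\ (0 < rho_inf R r A B)%E.
Proof.
move=> A B; have [eps_big|eps_small] := leP (d%:R / 2) eps.
  (* Now every graph of degree at most [d] lies in [A], so [B] must be empty. This follows from
     [eps_large], and 1 is vacuously a lower bound. *)
  exists 1%N; split=> //; apply: (@lt_le_trans _ _ 1%E); first by rewrite lte_fin.
  apply: le_ereal_inf_tmp => x [G [G' [_ [dG' nhf] _]]]; case: nhf.
  exact: hyperfinite_all_edges k_gt0 dG' (eps_large eps_big).
pose M : R := sq_bound R d k.
have M_gt0 : 0 < M.
  by rewrite mulr_gt0 ?exprn_gt0 ?ltr0n ?muln_gt0 ?d_gt0 // expn_gt0.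
have [eta etaE] : exists eta, eta = eps / M by exists (eps / M).
have eta_ge0 : 0 <= eta by rewrite etaE divr_ge0 // ltW.
have [T TM] : exists T, M < T%:R * eps ^+ 2.
  exists (Num.bound (M / eps ^+ 2)); rewrite -ltr_pdivrMr ?exprn_gt0 //.
  by rewrite archi_boundP // divr_ge0 ?exprn_ge0 ?ltW.
have T_gt0 : (0 < T)%N.
  by case: T TM => //; rewrite mul0r ltNge ltW.
pose b := local_cost_bound d k eta T.
have b_gt0 : 0 < b by rewrite ltr_wpDl ?ltr0n // !mulr_ge0.
have bT t : (t <= T)%N -> local_cost_bound d k eta t <= b.
  by move=> tT; rewrite lerD2r ler_wpM2l // ler_wpM2r // ler_wpM2r ?ler_nat // mulr_ge0.
(* The radius and [b] use [T], since the good time [t < T] found below depends on [G]. *)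
exists (T * k + (k + k + 1))%N; split; first by rewrite addnA addn1.
apply: (@lt_le_trans _ _ (eps / b)%:E); first by rewrite lte_fin divr_gt0.
apply: le_ereal_inf_tmp => _ [G [G' [[hfG dG] [dG' nhfG'] ->]]].
have [y [y0 yc ysq yobj]] := hyperfinite_competitor d hfG.
have [t tT tobj] := descent_converges dG y0 yc ysq eps_gt0 etaE M_gt0 TM T_gt0.
pose L (H : sgraph) (v : H) := local_cost d (@descent R d k eta H t) v.
have Lb (H : sgraph) (v : H) : max_degree_le d H -> `|L H v| <= b.
  by move=> dH; apply: le_trans (bT _ (ltnW tT)); exact: local_cost_le.
have Liso (H H' : sgraph) (v : H) (v' : H') :
    rooted_iso (rooted_ball v (T * k + (k + k + 1))) (rooted_ball v' (T * k + (k + k + 1))) ->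
    L H v = L H' v'.
  move=> /rooted_iso_ball_iso[phi <- hphi]; apply/esym.
  by apply: local_cost_local hphi _; rewrite leq_add2r leq_mul2r (ltnW tT) orbT.
(* It remains to see that the average local costs, at most [3 * eps] on [G] and at least [4 * eps]
   on [G'], differ by at least [eps]. *)
rewrite mulrC EFinM lee_pdivrMl //.
apply: le_trans (rho_ge Liso (fun v => Lb G v dG) (fun v => Lb G' v dG') (ltW b_gt0)).
rewrite lee_fin distrC; apply: le_trans (ler_norm _).
rewrite !sum_local_cost.
have low : objective d (@descent R d k eta G t) / #|G|%:R <= 3 * eps.
  (* On the empty graph the average is 0, as division by 0 gives 0. *)
  have [G0|G_gt0] := posnP #|G|; first by rewrite G0 invr0 mulr0 mulr_ge0 // ltW.
  by rewrite ler_pdivrMr ?ltr0n //; lra.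
have high : 4 * eps <= objective d (@descent R d k eta G' t) / #|G'|%:R.
  have [G0|G_gt0] := posnP #|G'|; first by case: nhfG'; exact: hyperfinite_empty.
  (* A smaller cost on [G'] could be rounded, contradicting [G'] in [B]. *)
  rewrite ler_pdivlMr ?ltr0n // leNgt; apply/negP => /ltW h; apply: nhfG'.
  apply: low_objective_hyperfinite h => // K; first exact: descent_ge0.
  exact: descent_kcluster.
lra.
Qed.
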